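(* Let $k$ be a field and let $\mathbf{QSh}=\bigoplus_{n\ge0}\mathbf{QSh}_n$ be the operad of quasi-shuffle algebras with its NQSh bialgebra structure. The operad $\mathbf{Com}$ of (nonunital) commutative algebras, embedded in $\mathbf{QSh}$ by sending the generator $x_1\cdots x_n$ of the one-dimensional space $\mathbf{Com}_n$ ($n\geq 1$) to the length-one tensor $x_{[n]}=x_1\bullet\cdots\bullet x_1$ ($n$ factors), is contained in the space of primitive elements of the NQSh bialgebra $\mathbf{QSh}$. Moreover the space of primitive elements of $\mathbf{QSh}$ is stable under the product $\bullet$.
   Context: $\mathbf{QSh}_n$ has basis the tensors $x_{\mathcal I}=x_{I_1}\otimes\cdots\otimes x_{I_p}$ indexed by the ordered partitions $\mathcal I=(I_1,\dots,I_p)$ of $[n]=\{1,\dots,n\}$ into nonempty blocks ($\mathbf{QSh}_0=k\cdot 1$). Here $x_I=\prod_{i\in I}x_i$ lies in the nonunital commutative algebra $W$ of polynomials without constant term in variables $x_i$, $i\ge1$, and $x_{\mathcal I}\in T^+(W)=\bigoplus_{n\ge1}W^{\otimes n}$. On $T^+(W)$ define inductively, for $a,b\in W$ and tensors (words) $v,w\in T(W)$: $av\prec_f bw=a(v\star_f bw)$, $av\succ_f bw=b(av\star_f w)$, $av\bullet_f bw=(a\cdot b)(v\star_f w)$, with $\star_f=\prec_f+\succ_f+\bullet_f$ and $1\star_f v=v\star_f1=v$. Let $\Delta_f(w_1\cdots w_n)=\sum_{i=0}^n w_1\cdots w_i\otimes w_{i+1}\cdots w_n$. The products on $\mathbf{QSh}$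 are, for $\mathcal I$ an ordered partition of $[n]$ and $\mathcal J$ one of $[m]$ ($n,m\ge1$): $x_{\mathcal I}\mathbin{\diamond} x_{\mathcal J}:=x_{\mathcal I}\mathbin{\diamond_f} x_{\mathcal J+n}$ for $\diamond\in\{\prec,\succ,\bullet\}$, where $\mathcal J+n$ is obtained by adding $n$ to all elements of all blocks. The coproduct is $\Delta=(st\otimes st)\circ\Delta_f$, where $st(x_{\mathcal I})$ is obtained by relabelling the elements of $I_1\sqcup\cdots\sqcup I_p$ by the increasing bijection onto $\{1,\dots,|I_1|+\cdots+|I_p|\}$ (and $st(1)=1$). An element $x\in\bigoplus_{n\ge1}\mathbf{QSh}_n$ is primitive if $\Delta(x)=x\otimes1+1\otimes x$. *)

(* Defs.v *)
From HB Require Import structures.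
From mathcomp Require Import all_boot all_algebra finmap.
From mathcomp.multinomials Require Import monalg.

Set Implicit Arguments.
Unset Strict Implicit.
Unset Printing Implicit Defensive.

Import GRing.Theory.
Local Open Scope fset_scope.
Local Open Scope ring_scope.

(* Indices start at 0: the variable x_(i+1) is U_i, and [n] = {1, ..., n} is
   {0, ..., n-1}. *)
Definition mon : choiceType := {cmonom nat}.

Definition relabel_mon (f : nat -> nat) (m : mon) : mon :=
  \big[mmul/mone]_(i <- finsupp m) expcmn (ucm (f i)) (m i).

Lemma mdeg_expcmn (m : mon) n : mdeg (expcmn m n) = (n * mdeg m)%N.
Proof.
rewrite /expcmn; case: n => [|n]; first by rewrite /= mdeg1.
rewrite iteropS; elim: n => [|n IHn]; first by rewrite mul1n.
by rewrite iterS mulSn -IHn -mdegM.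
Qed.

Lemma mdeg_relabel_mon f (m : mon) : mdeg (relabel_mon f m) = mdeg m.
Proof.
rewrite /relabel_mon mdeg_prod mdegE; apply: eq_bigr => i _.
by rewrite mdeg_expcmn mdegU muln1.
Qed.

Lemma relabel_mon_neq1 f (m : mon) : m != mone -> relabel_mon f m != mone.
Proof. by rewrite -!mdeg_eq0 mdeg_relabel_mon. Qed.

Lemma mmul_neq1 (m1 m2 : mon) : m1 != mone -> mmul m1 m2 != mone.
Proof. by apply: contraNN => /unitmP[]. Qed.

(* The monomials other than 1, a basis of W. *)
Record letter := Letter { letter_mon :> mon; _ : letter_mon != mone }.
HB.instance Definition _ := [isSub for letter_mon].
HB.instance Definition _ := [Choice of letter by <:].

Definition lmul (a b : letter) : letter := Letter (mmul_neq1 b (valP a)).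
Definition relabel (f : nat -> nat) (a : letter) : letter :=
  Letter (relabel_mon_neq1 f (valP a)).

Definition word := seq letter.

Definition shift (n : nat) (w : word) : word := map (relabel (addn n)) w.

Definition wsupp (w : word) : {fset nat} :=
  \bigcup_(a <- w) finsupp (letter_mon a).
(* The number of elements of S smaller than i: on S, this is the increasing
   bijection onto {0, ..., #|S| - 1}. *)
Definition rank (S : {fset nat}) (i : nat) : nat :=
  #|` [fset j in S | (j < i)%N]|.
Definition stw (w : word) : word := map (relabel (rank (wsupp w))) w.

Definition wdeg (w : word) : nat := (\sum_(a <- w) mdeg (letter_mon a))%N.

Definition initseg (n : nat) : {fset nat} := [fset i in iota 0 n].
Definition xset (I : {fset nat}) : mon := \big[mmul/mone]_(i <- I) ucm i.

Definition ordered_partition (n : nat) (Is : seq {fset nat}) : Prop :=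
  [/\ fset0 \notin Is, pairwise (fun I J => [disjoint I & J]) Is
    & \bigcup_(I <- Is) I = initseg n].

(* w is the tensor x_I of an ordered partition I of [n]. *)
Definition QSh_basis (n : nat) (w : word) : Prop :=
  exists2 Is, ordered_partition n Is
            & map letter_mon w = map xset Is.

Lemma mdeg_xset I : mdeg (xset I) = #|` I|.
Proof.
rewrite /xset mdeg_prod (eq_bigr (fun=> 1%N)) => [|i _]; last exact: mdegU.
by rewrite big_const_seq count_predT iter_addn_0 mul1n.
Qed.

Lemma xset_initseg_neq1 n : xset (initseg n.+1) != mone.
Proof.
rewrite -mdeg_eq0 mdeg_xset cardfs_eq0; apply/fset0Pn; exists 0%N.
by rewrite in_fset.
Qed.

(* The monomial x_1 ... x_(n+1), generator of Com_(n+1). *)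
Definition comgen (n : nat) : letter := Letter (xset_initseg_neq1 n).

Section LinearExtension.
Variables (k : fieldType).

Definition lext (K : choiceType) (V : lmodType k) (f : K -> V)
  (x : {malg k[K]}) : V := \sum_(u <- msupp x) x@_u *: f u.

Definition lext2 (K L : choiceType) (V : lmodType k) (f : K -> L -> V)
  (x : {malg k[K]}) (y : {malg k[L]}) : V :=
  lext (fun u => lext (f u) y) x.

Lemma lextEw (K : choiceType) (V : lmodType k) (f : K -> V) (d : {fset K}) x :
  msupp x `<=` d -> lext f x = \sum_(u <- d) x@_u *: f u.
Proof.
move=> le_xd; rewrite /lext (big_fset_incl _ le_xd) // => u _ u_notin.
by rewrite mcoeff_outdom // scale0r.
Qed.

Lemma lext_linear (K : choiceType) (V : lmodType k) (f : K -> V) :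
  linear (lext f).
Proof.
move=> c x y; pose d := msupp x `|` msupp y `|` msupp (c *: x + y).
have sxd: msupp x `<=` d by rewrite /d -fsetUA fsubsetUl.
have syd: msupp y `<=` d by rewrite /d fsetUAC fsubsetUr.
rewrite (lextEw f sxd) (lextEw f syd) (lextEw f (fsubsetUr _ _ : _ `<=` d)).
rewrite scaler_sumr -big_split; apply: eq_bigr => u _ /=.
by rewrite mcoeffD mcoeffZ scalerDl scalerA.
Qed.

HB.instance Definition _ (K : choiceType) (V : lmodType k) (f : K -> V) :=
  GRing.isLinear.Build k {malg k[K]} V *:%R (lext f) (lext_linear f).

Lemma lextU (K : choiceType) (V : lmodType k) (f : K -> V) u :
  lext f << u >> = f u.
Proof. by rewrite /lext msuppU oner_eq0 big_seq_fset1 mcoeffUU scale1r. Qed.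

Lemma lext2Pl (K L : choiceType) (V : lmodType k) (f : K -> L -> V) c x x' y :
  lext2 f (c *: x + x') y = c *: lext2 f x y + lext2 f x' y.
Proof. exact: linearP. Qed.

Lemma lext2Pr (K L : choiceType) (V : lmodType k) (f : K -> L -> V) c x y y' :
  lext2 f x (c *: y + y') = c *: lext2 f x y + lext2 f x y'.
Proof.
rewrite /lext2 ![lext _ x]/lext scaler_sumr -big_split.
by apply: eq_bigr => u _; rewrite linearP scalerDr !scalerA mulrC.
Qed.

Lemma lext20l (K L : choiceType) (V : lmodType k) (f : K -> L -> V) y :
  lext2 f 0 y = 0.
Proof. exact: linear0. Qed.

Lemma lext20r (K L : choiceType) (V : lmodType k) (f : K -> L -> V) x :
  lext2 f x 0 = 0.
Proof. by rewrite /lext2 [LHS]/lext big1 // => u _; rewrite linear0 scaler0. Qed.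

Lemma lext2U (K L : choiceType) (V : lmodType k) (f : K -> L -> V) u v :
  lext2 f << u >> << v >> = f u v.
Proof. by rewrite /lext2 !lextU. Qed.

Lemma malg_ind (K : choiceType) (P : {malg k[K]} -> Prop) :
    P 0 -> (forall u, P << u >>) ->
    (forall c x y, P x -> P y -> P (c *: x + y)) ->
  forall x, P x.
Proof.
move=> P0 PU PP x; rewrite [x]monalgE; apply: big_ind => // [y z Py Pz|u _].
  by rewrite -[y]scale1r; apply: PP.
suff -> : << x@_u *g u >> = x@_u *: << u >> + 0 by apply: PP.
by apply/malgP => v; rewrite addr0 mcoeffZ !mcoeffU mulr_natr.
Qed.

Lemma eq_malg_linear (K : choiceType) (V : lmodType k)
    (f g : {malg k[K]} -> V) :
    linear f -> linear g -> (forall u, f << u >> = g << u >>) -> f =1 g.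
Proof.
move=> lf lg eq_fg; elim/malg_ind => [|//|c x y Hx Hy].
  have := lf (-1) 0 0; have := lg (-1) 0 0.
  by rewrite !scaleN1r !oppr0 !addr0 !addNr => -> ->.
by rewrite lf lg Hx Hy.
Qed.

Lemma eq_malg_linear4 (K1 K2 K3 K4 : choiceType) (V : lmodType k)
    (F G : {malg k[K1]} -> {malg k[K2]} -> {malg k[K3]} -> {malg k[K4]} -> V) :
    (forall v b w, linear (fun a => F a v b w)) ->
    (forall a b w, linear (fun v => F a v b w)) ->
    (forall a v w, linear (fun b => F a v b w)) ->
    (forall a v b, linear (fun w => F a v b w)) ->
    (forall v b w, linear (fun a => G a v b w)) ->
    (forall a b w, linear (fun v => G a v b w)) ->
    (forall a v w, linear (fun b => G a v b w)) ->
    (forall a v b, linear (fun w => G a v b w)) ->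
    (forall a v b w, F << a >> << v >> << b >> << w >> =
                     G << a >> << v >> << b >> << w >>) ->
  forall a v b w, F a v b w = G a v b w.
Proof.
move=> F1 F2 F3 F4 G1 G2 G3 G4 eqFG a v b w.
apply: (eq_malg_linear (F1 v b w) (G1 v b w)) => {}a.
apply: (eq_malg_linear (F2 _ b w) (G2 _ b w)) => {}v.
apply: (eq_malg_linear (F3 _ _ w) (G3 _ _ w)) => {}b.
exact: (eq_malg_linear (F4 _ _ _) (G4 _ _ _)).
Qed.

End LinearExtension.

Section QuasiShuffle.
Variable k : fieldType.

(* A vector space with a basis is the free module on it: W has basis the
   monomials other than 1, TW = T(W) has basis the words on these monomials, the
   length-p words spanning the p-th tensor power of W, and TW2 = T(W) (x) T(W)
   has basis the pairs of words. *)
Definition W := {malg k[letter]}.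
Definition TW := {malg k[word]}.
Definition TW2 := {malg k[(word * word)%type]}.

Definition tens : TW -> TW -> TW2 := lext2 (fun u v => << (u, v) >>).

(* The tensor a v, for a in W and v in T(W). *)
Definition tcons : W -> TW -> TW := lext2 (fun a w => << a :: w >>).

Definition wmul : W -> W -> W := lext2 (fun a b => << lmul a b >>).

Fixpoint star_word (u : word) : word -> TW :=
  match u with
  | [::] => fun v => << v >>
  | a :: u' =>
    fix star_au (v : word) : TW :=
      match v with
      | [::] => << a :: u' >>
      | b :: v' => tcons << a >> (star_word u' (b :: v'))
                 + tcons << b >> (star_au v')
                 + tcons << lmul a b >> (star_word u' v')
      end
  end.

(* The half products are only defined on T^+(W); a word of length 0 is given
   the value 0. *)
Definition prec_word (u v : word) : TW :=
  match u, v with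
  | a :: u', b :: _ => tcons << a >> (star_word u' v)
  | _, _ => 0
  end.

Definition succ_word (u v : word) : TW :=
  match u, v with
  | _ :: _, b :: v' => tcons << b >> (star_word u v')
  | _, _ => 0
  end.

Definition bullet_word (u v : word) : TW :=
  match u, v with
  | a :: u', b :: v' => tcons << lmul a b >> (star_word u' v')
  | _, _ => 0
  end.

Definition star_f : TW -> TW -> TW := lext2 star_word.
Definition prec_f : TW -> TW -> TW := lext2 prec_word.
Definition succ_f : TW -> TW -> TW := lext2 succ_word.
Definition bullet_f : TW -> TW -> TW := lext2 bullet_word.

Lemma star_wordE a u b v :
  let au := a :: u in let bv := b :: v in
  star_word au bv = prec_word au bv + succ_word au bv + bullet_word au bv.
Proof. by []. Qed.

Lemma star_f1 x : star_f x << [::] >> = x /\ star_f << [::] >> x = x.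
Proof.
rewrite /star_f; split; elim/malg_ind: x => [|u|c x y Hx Hy].
- exact: lext20l.
- by rewrite lext2U; case: u.
- by rewrite lext2Pl Hx Hy.
- exact: lext20r.
- by rewrite lext2U.
- by rewrite lext2Pr Hx Hy.
Qed.

Lemma tconsU a w : tcons << a >> << w >> = << a :: w >>.
Proof. exact: lext2U. Qed.

Lemma star_fU u v : star_f << u >> << v >> = star_word u v.
Proof. exact: lext2U. Qed.

(* The recursions for arbitrary a, b in W and v, w in T(W). *)
Lemma prec_fE (a b : W) (v w : TW) :
  prec_f (tcons a v) (tcons b w) = tcons a (star_f v (tcons b w)).
Proof.
pose F a v b w := prec_f (tcons a v) (tcons b w).
pose G a v b w := tcons a (star_f v (tcons b w)).
apply: (@eq_malg_linear4 _ _ _ _ _ _ F G); last first.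
  move=> {}a {}v {}b {}w.
  have -> : F << a >> << v >> << b >> << w >> = prec_word (a :: v) (b :: w).
    exact: etrans (congr2 prec_f (tconsU a v) (tconsU b w)) (lext2U _ _ _).
  have E : star_f << v >> (tcons << b >> << w >>) = star_word v (b :: w).
    exact: etrans (congr1 (star_f << v >>) (tconsU b w)) (star_fU _ _).
  exact (esym (congr1 (tcons << a >>) E)).
all: move=> ? ? ? c x y; rewrite /F /G /prec_f /star_f /tcons.
all: by rewrite ?(lext2Pl, lext2Pr).
Qed.

Lemma succ_fE (a b : W) (v w : TW) :
  succ_f (tcons a v) (tcons b w) = tcons b (star_f (tcons a v) w).
Proof.
pose F a v b w := succ_f (tcons a v) (tcons b w).
pose G a v b w := tcons b (star_f (tcons a v) w).
apply: (@eq_malg_linear4 _ _ _ _ _ _ F G); last first.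
  move=> {}a {}v {}b {}w.
  have -> : F << a >> << v >> << b >> << w >> = succ_word (a :: v) (b :: w).
    exact: etrans (congr2 succ_f (tconsU a v) (tconsU b w)) (lext2U _ _ _).
  have E : star_f (tcons << a >> << v >>) << w >> = star_word (a :: v) w.
    exact: etrans (congr1 (star_f^~ << w >>) (tconsU a v)) (star_fU _ _).
  exact (esym (congr1 (tcons << b >>) E)).
all: move=> ? ? ? c x y; rewrite /F /G /succ_f /star_f /tcons.
all: by rewrite ?(lext2Pl, lext2Pr).
Qed.

Lemma bullet_fE (a b : W) (v w : TW) :
  bullet_f (tcons a v) (tcons b w) = tcons (wmul a b) (star_f v w).
Proof.
pose F a v b w := bullet_f (tcons a v) (tcons b w).
pose G a v b w := tcons (wmul a b) (star_f v w).
apply: (@eq_malg_linear4 _ _ _ _ _ _ F G); last first.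
  move=> {}a {}v {}b {}w.
  have -> : F << a >> << v >> << b >> << w >> = bullet_word (a :: v) (b :: w).
    exact: etrans (congr2 bullet_f (tconsU a v) (tconsU b w)) (lext2U _ _ _).
  have E : wmul << a >> << b >> = << lmul a b >> by exact: lext2U.
  exact (esym (congr2 tcons E (star_fU v w))).
all: move=> ? ? ? c x y; rewrite /F /G /bullet_f /star_f /tcons /wmul.
all: by rewrite ?(lext2Pl, lext2Pr).
Qed.

Definition Delta_f : TW -> TW2 :=
  lext (fun w => \sum_(i < (size w).+1) << (take i w, drop i w) >>).

(* The direct sum of the QSh_n over n >= 1, QSh_n being the subspace of T(W)
   with basis the tensors of the ordered partitions of [n]. *)
Definition QSh_plus (x : TW) : Prop :=
  forall w, w \in msupp x -> exists2 n, (0 < n)%N & QSh_basis n w.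

(* If u is the tensor of an ordered partition of [n], then wdeg u = n. *)
Definition prec : TW -> TW -> TW :=
  lext2 (fun u v => prec_word u (shift (wdeg u) v)).
Definition succ : TW -> TW -> TW :=
  lext2 (fun u v => succ_word u (shift (wdeg u) v)).
Definition bullet : TW -> TW -> TW :=
  lext2 (fun u v => bullet_word u (shift (wdeg u) v)).

Definition st2 : TW2 -> TW2 := lext (fun p => << (stw p.1, stw p.2) >>).
Definition Delta (x : TW) : TW2 := st2 (Delta_f x).

Definition QSh1 : TW := << [::] >>.

Definition primitive (x : TW) : Prop :=
  QSh_plus x /\ Delta x = tens x QSh1 + tens QSh1 x.

(* The direct sum of the one-dimensional spaces Com_n, n >= 1. *)
Definition Com (p : W) : Prop :=
  forall m, m \in msupp p -> exists n, m = comgen n.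

Definition tens1 : W -> TW := lext (fun a => << [:: a] >>).

Lemma mcoeff_tens1 p a : (tens1 p)@_[:: a] = p@_a.
Proof.
rewrite /tens1; elim/malg_ind: p => [|b|c x y Hx Hy].
- by rewrite linear0 !mcoeff0.
- by rewrite lextU !mcoeffU eqseq_cons andbT.
- by rewrite linearP !mcoeffD !mcoeffZ Hx Hy.
Qed.

Lemma tens1_inj : injective tens1.
Proof.
by move=> p q eq_pq; apply/malgP => a; rewrite -!mcoeff_tens1 eq_pq.
Qed.

End QuasiShuffle.

(* Main.v *)
(* Deconcatenation is compatible with the quasi-shuffle product, and a product
   x . y of nonempty words starts with the product of the first letters of x and
   y; hence, in Sweedler notation,
     Delta_f (x . y) = 1 (x) (x . y) + sum (x1 . y1) (x) (x2 * y2),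
   where x1 . y1 vanishes as soon as x1 or y1 is empty.  When the letters of x lie
   in [n] and those of y are shifted by n, all words of a product of cuts x1, y1
   have the same support, on which standardization is the relabelling by a single
   increasing map; so standardization turns these products into shifted products
   of standardized words, and the formula holds for Delta.  If x and y are
   primitive, the only surviving term of the sum is (x . y) (x) 1. *)
Require Import Defs.
From HB Require Import structures.
From mathcomp Require Import all_boot all_algebra finmap.
From mathcomp.multinomials Require Import monalg.

Set Implicit Arguments.
Unset Strict Implicit.
Unset Printing Implicit Defensive.

Import GRing.Theory.
Local Open Scope ring_scope.

(** * Words and standardization *)

Section Words.
Local Open Scope fset_scope.
Local Open Scope nat_scope.

Implicit Types (m : mon) (a b : letter) (u v w : word).

Lemma mon_eqP m1 m2 : (forall i, m1 i = m2 i) -> m1 = m2.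
Proof. by move=> e; apply/eqP/cmP. Qed.

Lemma mon_prodE (I : Type) (r : seq I) (F : I -> mon) j :
  (\big[mmul/mone]_(i <- r) F i) j = \sum_(i <- r) F i j.
Proof.
elim: r => [|i r IHr]; first by rewrite !big_nil cm1.
by rewrite !big_cons cmM IHr.
Qed.

Lemma expcmnE m n j : expcmn m n j = n * m j.
Proof.
rewrite /expcmn; case: n => [|n]; first exact: cm1.
rewrite iteropS; elim: n => [|n IHn]; first by rewrite mul1n.
by rewrite iterS mulcmE IHn mulSn.
Qed.

(** Summing over any [S] that contains the support lets several monomials be compared over one index
    set. *)
Lemma relabel_monE f m (S : {fset nat}) j : finsupp m `<=` S ->
  relabel_mon f m j = \sum_(i <- S) m i * (f i == j).
Proof.
move=> mS; rewrite mon_prodE.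
rewrite (big_fset_incl _ mS) => [|i _ im].
  by apply: eq_bigr => i _; rewrite expcmnE cmU.
by rewrite expcmnE (fsfun_dflt im).
Qed.

Lemma relabel_mon1 f : relabel_mon f mone = mone.
Proof. by rewrite /relabel_mon mdom1 big_seq_fset0. Qed.

Lemma relabel_monM f m1 m2 :
  relabel_mon f (mmul m1 m2) = mmul (relabel_mon f m1) (relabel_mon f m2).
Proof.
apply: mon_eqP => j; rewrite cmM.
rewrite (relabel_monE _ _ (fsubset_refl _)).
rewrite !(@relabel_monE f _ (finsupp (mmul m1 m2))) ?mdomD;
  rewrite ?fsubsetUl ?fsubsetUr //.
by rewrite -big_split; apply: eq_bigr => i _; rewrite cmM mulnDl.
Qed.

Lemma relabel_monU f i : relabel_mon f (ucm i) = ucm (f i).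
Proof.
by rewrite /relabel_mon mdomU big_seq_fset1 cmUU.
Qed.

(** Multiplicativity of relabelling reduces the claim to powers of a single variable. *)
Lemma relabel_mon_comp f g m :
  relabel_mon f (relabel_mon g m) = relabel_mon (f \o g) m.
Proof.
rewrite [relabel_mon g m]/relabel_mon.
rewrite (big_morph _ (relabel_monM f) (relabel_mon1 f)).
apply: eq_bigr => i _; rewrite /expcmn; case: (m i) => [|n].
  exact: relabel_mon1.
rewrite !iteropS; elim: n => [|n IHn] /=; first exact: relabel_monU.
by rewrite relabel_monM IHn relabel_monU.
Qed.

Lemma eq_in_relabel_mon f g m : {in finsupp m, f =1 g} ->
  relabel_mon f m = relabel_mon g m.
Proof. by move=> e; apply: eq_big_seq => i /e ->. Qed.

Lemma relabel_mon_id m : relabel_mon id m = m.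
Proof.
apply: mon_eqP => j.
(* Adjoining [j] to the index set isolates its term whether or not [j] occurs in [m]. *)
rewrite (relabel_monE _ _ (fsubsetUr [fset j] _)) (big_fsetD1 j) ?fset1U1 //=.
rewrite eqxx muln1 big_seq big1 ?addn0 // => i.
by rewrite in_fsetD1 => /andP[/negPf-> _]; rewrite muln0.
Qed.

(** Exponents are natural numbers, so nothing cancels when [f] identifies variables. *)
Lemma finsupp_relabel_mon f m : finsupp (relabel_mon f m) = f @` finsupp m.
Proof.
apply/fsetP => j; rewrite -cmE_neq0 (relabel_monE _ _ (fsubset_refl _)).
rewrite sum_nat_seq_neq0; apply/hasP/imfsetP => /= [[i im]|[i im ->]].
  by rewrite muln_eq0 negb_or eqb0 negbK => /andP[_ /eqP <-]; exists i.
by exists i => //; rewrite eqxx muln1 cmE_neq0.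
Qed.

Lemma relabelM f a b : relabel f (lmul a b) = lmul (relabel f a) (relabel f b).
Proof. exact/val_inj/relabel_monM. Qed.

Lemma eq_in_relabel f g a :
  {in finsupp (letter_mon a), f =1 g} -> relabel f a = relabel g a.
Proof. by move=> e; apply/val_inj/eq_in_relabel_mon. Qed.

Lemma relabel_comp f g a : relabel f (relabel g a) = relabel (f \o g) a.
Proof. exact/val_inj/relabel_mon_comp. Qed.

Lemma relabel_id a : relabel id a = a.
Proof. exact/val_inj/relabel_mon_id. Qed.

Lemma wsupp_nil : wsupp [::] = fset0.
Proof. exact: big_nil. Qed.

Lemma wsupp_cons a w : wsupp (a :: w) = finsupp (letter_mon a) `|` wsupp w.
Proof. exact: big_cons. Qed.

Lemma wsupp_cat u v : wsupp (u ++ v) = wsupp u `|` wsupp v.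
Proof. exact: big_cat. Qed.

Lemma wdeg_nil : wdeg [::] = 0.
Proof. exact: big_nil. Qed.

Lemma wdeg_cons a w : wdeg (a :: w) = mdeg (letter_mon a) + wdeg w.
Proof. exact: big_cons. Qed.

Lemma wdeg_cat u v : wdeg (u ++ v) = wdeg u + wdeg v.
Proof. exact: big_cat. Qed.

Lemma wsupp_relabel f w : wsupp (map (relabel f) w) = f @` wsupp w.
Proof.
elim: w => [|a w IHw] /=; first by rewrite wsupp_nil imfset0.
by rewrite !wsupp_cons IHw finsupp_relabel_mon imfsetU.
Qed.

Lemma wdeg_relabel f w : wdeg (map (relabel f) w) = wdeg w.
Proof.
by rewrite /wdeg big_map; apply: eq_bigr => a _; apply: mdeg_relabel_mon.
Qed.

Lemma eq_in_map_relabel f g w :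
  {in wsupp w, f =1 g} -> map (relabel f) w = map (relabel g) w.
Proof.
move=> e; apply/eq_in_map => a aw; apply: eq_in_relabel => i ia.
by apply: e; apply/bigfcupP; exists a; rewrite ?aw.
Qed.

Lemma map_relabel_comp f g w :
  map (relabel f) (map (relabel g) w) = map (relabel (f \o g)) w.
Proof. by rewrite -map_comp; apply: eq_map => a; apply: relabel_comp. Qed.

Lemma map_relabel_id f w : {in wsupp w, f =1 id} -> map (relabel f) w = w.
Proof.
move=> /eq_in_map_relabel->; rewrite -[RHS]map_id.
by apply: eq_map => a; apply: relabel_id.
Qed.

(** * Initial segments and ranks *)

Lemma in_initseg n i : (i \in initseg n) = (i < n).
Proof. by rewrite in_fset /= mem_iota. Qed.

Lemma card_initseg n : #|` initseg n| = n.
Proof. by rewrite card_fseq undup_id ?iota_uniq // size_iota. Qed.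

Lemma in_below (S : {fset nat}) i j :
  (j \in [fset x in S | x < i]) = (j \in S) && (j < i).
Proof. by rewrite !inE. Qed.

Lemma rank_initseg n i : i <= n -> rank (initseg n) i = i.
Proof.
move=> le_in; rewrite -[RHS]card_initseg; congr #|` _|; apply/fsetP => j.
rewrite in_below !in_initseg andbC.
by case: ltnP => // /leq_trans->.
Qed.

(** Every element of the shifted copy of [B] is at least [n], hence not below [i]. *)
Lemma rankUl n (A B : {fset nat}) i :
  i < n -> rank (A `|` addn n @` B) i = rank A i.
Proof.
move=> lt_in; congr #|` _|; apply/fsetP => j; rewrite !in_below in_fsetU.
case: ltnP => [lt_ji|_]; rewrite ?andbF // !andbT orb_idr //.
case/imfsetP=> b _ ej.
by move: (ltn_trans lt_ji lt_in); rewrite ej ltnNge leq_addr.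
Qed.

(** All of [A] lies below [n], and the shift preserves the order of [B]: the set to count is the
    disjoint union of [A] and the shifted elements of [B] below [i]. *)
Lemma rankUr n (A B : {fset nat}) i : A `<=` initseg n ->
  rank (A `|` addn n @` B) (n + i) = #|` A| + rank B i.
Proof.
move=> /fsubsetP An; rewrite /rank.
have <- : #|` addn n @` [fset x in B | x < i]| = #|` [fset x in B | x < i]|.
  by rewrite card_imfset //; apply: addnI.
rewrite -cardfsUI [X in _ = _ + #|` X|](_ : _ = fset0) ?cardfs0 ?addn0.
  congr #|` _|; apply/fsetP => j; rewrite ?(in_below, in_fsetU, in_fsetI).
  apply/andP/orP => [[/orP[jA|/imfsetP[/= b bB ->]]]|[jA|/imfsetP[/= b]]].
  - by left.
  - by rewrite ltn_add2l => bi; right; apply/imfsetP; exists b;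
      rewrite ?in_below ?bB.
  - have := An _ jA; rewrite in_initseg jA => lt_jn; split=> //.
    exact: ltn_addr.
  - rewrite ?(in_below, in_fsetU, in_fsetI) => /andP[bB bi] ->.
    rewrite ltn_add2l bi; split=> //.
    by rewrite in_imfset ?orbT.
apply/fsetP => j; rewrite ?(in_below, in_fsetU, in_fsetI); apply/andP => -[/An].
rewrite in_initseg => lt_jn /imfsetP[b _ ej].
by move: lt_jn; rewrite ej ltnNge leq_addr.
Qed.

(** * Multilinear words and ordered partitions *)

Lemma card_finsupp_le m : #|` finsupp m| <= mdeg m.
Proof.
rewrite mdegE -sum1_size !big_seq; apply: leq_sum => i.
by rewrite -cmE_neq0 lt0n.
Qed.

Lemma card_wsupp_le w : #|` wsupp w| <= wdeg w.
Proof.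
elim: w => [|a w IHw]; first by rewrite wsupp_nil cardfs0.
rewrite wsupp_cons wdeg_cons cardfsU (leq_trans (leq_subr _ _)) //.
by rewrite leq_add ?card_finsupp_le.
Qed.

(* No variable occurs twice in w. *)
Definition multilinear w := wdeg w = #|` wsupp w|.

(** The degree is additive, while the size of the support is subadditive and at most the degree;
    equality for [u ++ v] forces equality for both factors. *)
Lemma multilinear_cat u v :
  multilinear (u ++ v) -> multilinear u /\ multilinear v.
Proof.
rewrite /multilinear wdeg_cat wsupp_cat cardfsU => e.
have := card_wsupp_le u; have := card_wsupp_le v.
have := leq_subr #|` wsupp u `&` wsupp v| (#|` wsupp u| + #|` wsupp v|).
rewrite -e => h hv hu; have hs := leq_add hu hv; move: hs.
rewrite leq_eqVlt ltnNge h orbF eq_sym => /eqP es.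
split; apply/eqP; rewrite eqn_leq ?hu ?hv andbT.
  by rewrite -(leq_add2r (wdeg v)) es leq_add2l.
by rewrite -(leq_add2l (wdeg u)) es leq_add2r.
Qed.

(** Each exponent on the support is at least 1 and the exponents sum to the number of variables, so
    all equal 1. *)
Lemma xset_finsupp m : mdeg m = #|` finsupp m| -> m = xset (finsupp m).
Proof.
move=> e; apply: mon_eqP => j; rewrite mon_prodE.
case: (boolP (j \in finsupp m)) => [jm|jm]; last first.
  rewrite (fsfun_dflt jm) big_seq big1 // => i im; rewrite cmU.
  by case: eqVneq => // eij; rewrite -eij im in jm.
rewrite (big_fsetD1 j) //= cmUU big_seq big1 ?addn0 => [|i]; last first.
  by rewrite in_fsetD1 cmU => /andP[/negPf->].
apply/eqP; rewrite eqn_leq lt0n cmE_neq0 jm andbT.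
(* To bound [m j] by 1, the number of other variables is added to both sides, which turns the bound
   into a comparison with the degree. *)
rewrite -(leq_add2r #|` finsupp m `\ j|) add1n.
have ->: #|` finsupp m `\ j|.+1 = #|` finsupp m|.
  by rewrite [RHS](cardfsD1 j) [_ \in _]jm.
rewrite -e mdegE (big_fsetD1 j) //= leq_add2l -sum1_size !big_seq.
by apply: leq_sum => i; rewrite in_fsetD1 -cmE_neq0 lt0n => /andP[].
Qed.

Lemma finsupp_xset (I : {fset nat}) : finsupp (xset I) = I.
Proof.
rewrite /xset (big_morph (fun m : mon => finsupp m) (@mdomD _) mdom1).
by rewrite (eq_bigr _ (fun i _ => mdomU i)) bigfcup_imfset1 imfset_id.
Qed.

(** Trades the existence of a partition for conditions on support and degree, which can be followed
    through products and cuts. *)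
Lemma QSh_basisP n w :
  QSh_basis n w <-> wsupp w = initseg n /\ multilinear w.
Proof.
split=> [[Is [_ disjIs eIs] ew]|[en p]].
  suff [ws mw]: wsupp w = \bigcup_(I <- Is) I /\ multilinear w.
    by split=> //; rewrite ws.
  elim: Is w disjIs ew {eIs} => [|I Is IHIs] [|a w] //=.
    by rewrite /multilinear wsupp_nil wdeg_nil big_nil cardfs0.
  move=> /andP[/allP dI disjIs] [ea ew]; have [wI mw] := IHIs _ disjIs ew.
  rewrite /multilinear wsupp_cons wdeg_cons ea finsupp_xset mdeg_xset big_cons.
  rewrite -wI mw cardfsU (_ : I `&` wsupp w = fset0) ?cardfs0 ?subn0 //.
  rewrite wI; apply/eqP/fdisjointP => i iI.
  apply/bigfcupP => -[J /andP[JIs _] iJ].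
  by have /fdisjointP/(_ i iI) := dI _ JIs; rewrite iJ.
(* The blocks are recovered as the supports of the letters; they are nonempty because no letter is
   1. *)
exists (map (fun a : letter => finsupp (letter_mon a)) w); last first.
  rewrite -map_comp; elim: w p {en} => //= a w IHw p.
  have [ma mw] := multilinear_cat (u := [:: a]) p.
  congr cons; last exact: IHw.
  apply: xset_finsupp; move: ma; rewrite /multilinear wsupp_cons wdeg_cons.
  by rewrite wsupp_nil wdeg_nil addn0 fsetU0.
split; last by rewrite big_map.
  apply/mapP => -[a _ /esym/eqP]; apply/negP; have := valP a.
  rewrite -mdeg_eq0 mdegE; apply: contraNN => /eqP->.
  by rewrite big_seq_fset0.
elim: w p {en} => //= a w IHw p.
have [ma mw] := multilinear_cat (u := [:: a]) p.
rewrite IHw // andbT; apply/allP => _ /mapP[b bw ->].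
apply/fdisjointP => i ia; apply/negP => ib.
move: ma mw p; rewrite /multilinear !wsupp_cons !wdeg_cons.
rewrite wsupp_nil wdeg_nil addn0 fsetU0 cardfsU.
move=> -> ->; set c := #|` _ `&` _| => e.
have: i \in finsupp (letter_mon a) `&` wsupp w.
  by rewrite in_fsetI ia; apply/bigfcupP; exists b; rewrite ?bw.
have cx: c <= #|` finsupp (letter_mon a)|.
  exact: fsubset_leq_card (fsubsetIl _ _).
(* Here [e] reads x + y = x + y - c with c at most x, which is impossible for positive c. *)
have: c == 0.
  case: posnP => // c_gt0; move: cx c_gt0 e; clearbody c.
  set x := #|` _|; set y := #|` _| => cx c_gt0 e.
  have := ltn_subrL c (x + y); rewrite -e ltnn c_gt0 addn_gt0.
  by rewrite (leq_trans c_gt0 cx).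
by rewrite cardfs_eq0 => /eqP->.
Qed.

Lemma stw_initseg n w : wsupp w = initseg n -> stw w = w.
Proof.
move=> e; apply: map_relabel_id => i; rewrite e in_initseg => /ltnW.
exact: rank_initseg.
Qed.

Lemma wdeg_stw w : wdeg (stw w) = wdeg w.
Proof. exact: wdeg_relabel. Qed.

Section ShiftedRank.
Variables (n : nat) (u v : word).
Hypothesis u_lt_n : wsupp u `<=` initseg n.
Let S := wsupp u `|` wsupp (shift n v).

(** The letters shifted by [n] do not affect ranks below [n]. *)
Lemma rank_shift_left : map (relabel (rank S)) u = stw u.
Proof.
apply: eq_in_map_relabel => i /(fsubsetP u_lt_n); rewrite in_initseg => lt_in.
by rewrite /S wsupp_relabel rankUl.
Qed.

(** Ranks on the right are raised by the number of variables of [u], which is its degree by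
    multilinearity. This may be less than [n], since [u] may be only a piece of a word on [n]. *)
Lemma rank_shift_right : multilinear u ->
  map (relabel (rank S)) (shift n v) = shift (wdeg (stw u)) (stw v).
Proof.
move=> mu; rewrite wdeg_stw mu /stw /shift !map_relabel_comp.
apply: eq_in_map_relabel => i _ /=.
by rewrite /S /shift wsupp_relabel rankUr.
Qed.

End ShiftedRank.

End Words.

(** * Linear extension *)

Section Linear.
Variable k : fieldType.
Implicit Types (K L M : choiceType) (V : lmodType k).

(** [lext2] is by construction linear in its first argument; exchanging the sums gives the same
    access to the second. *)
Lemma lext2_swap K L V (f : K -> L -> V) (x : {malg k[K]}) (y : {malg k[L]}) :
  lext2 f x y = lext (fun v => lext (f^~ v) x) y.
Proof.
rewrite /lext2 /lext; under eq_bigr do rewrite scaler_sumr.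
rewrite exchange_big; apply: eq_bigr => v _; rewrite scaler_sumr.
by apply: eq_bigr => u _; rewrite !scalerA mulrC.
Qed.

Lemma eq_in_lext K V (f g : K -> V) (x : {malg k[K]}) :
  {in msupp x, f =1 g} -> lext f x = lext g x.
Proof. by move=> e; apply: eq_big_seq => u /e ->. Qed.

Lemma eq_in_lext2 K L V (f g : K -> L -> V) (x : {malg k[K]})
    (y : {malg k[L]}) :
  {in msupp x & msupp y, f =2 g} -> lext2 f x y = lext2 g x y.
Proof.
by move=> e; apply: eq_in_lext => u xu; apply: eq_in_lext => v yv; apply: e.
Qed.

Lemma lext_lext K L V (f : K -> V) (g : L -> {malg k[K]}) x :
  lext f (lext g x) = lext (fun u => lext f (g u)) x.
Proof.
by rewrite [lext g x]/lext linear_sum; apply: eq_bigr => u _; rewrite linearZ.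
Qed.

Lemma lext_lext2 K L M V (f : M -> V) (g : K -> L -> {malg k[M]}) x y :
  lext f (lext2 g x y) = lext2 (fun u v => lext f (g u v)) x y.
Proof.
by rewrite /lext2 lext_lext; apply: eq_in_lext => u _; rewrite lext_lext.
Qed.

Lemma lext2_lext K K' L L' V (f : K -> L -> V) (g : K' -> {malg k[K]})
    (h : L' -> {malg k[L]}) x y :
  lext2 f (lext g x) (lext h y) = lext2 (fun u v => lext2 f (g u) (h v)) x y.
Proof.
rewrite /lext2 lext_lext; apply: eq_in_lext => u _.
transitivity (lext2 f (g u) (lext h y)) => //.
rewrite lext2_swap lext_lext; apply: eq_in_lext => v _.
by rewrite [RHS]lext2_swap.
Qed.

Lemma lextD K V (f g : K -> V) (x : {malg k[K]}) :
  lext (fun u => f u + g u) x = lext f x + lext g x.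
Proof.
by rewrite /lext -big_split; apply: eq_bigr => u _; rewrite scalerDr.
Qed.

Lemma lext2D K L V (f g : K -> L -> V) (x : {malg k[K]}) (y : {malg k[L]}) :
  lext2 (fun u v => f u v + g u v) x y = lext2 f x y + lext2 g x y.
Proof. by rewrite -lextD; apply: eq_in_lext => u _; apply: lextD. Qed.

Lemma malg_lextE K (x : {malg k[K]}) : lext (fun u => << u >>) x = x.
Proof.
elim/malg_ind: x => [|u|c x y Hx Hy]; [exact: linear0 | exact: lextU |].
by rewrite linearP /= Hx Hy.
Qed.

Lemma lext2_eq0 K L V (f : K -> L -> V) (x : {malg k[K]}) (y : {malg k[L]}) :
  (forall u v, f u v = 0) -> lext2 f x y = 0.
Proof.
move=> f0; rewrite /lext2 {1}/lext big1 // => u _.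
by rewrite /lext big1 ?scaler0 // => v _; rewrite f0 scaler0.
Qed.

Lemma lext2Ul K L V (f : K -> L -> V) u (y : {malg k[L]}) :
  lext2 f << u >> y = lext (f u) y.
Proof. exact: lextU. Qed.

Lemma lext2Ur K L V (f : K -> L -> V) (x : {malg k[K]}) v :
  lext2 f x << v >> = lext (f^~ v) x.
Proof. by rewrite lext2_swap lextU. Qed.

Lemma lext2Dl K L V (f : K -> L -> V) (x x' : {malg k[K]}) (y : {malg k[L]}) :
  lext2 f (x + x') y = lext2 f x y + lext2 f x' y.
Proof. exact: linearD. Qed.

Lemma lext2Dr K L V (f : K -> L -> V) (x : {malg k[K]}) (y y' : {malg k[L]}) :
  lext2 f x (y + y') = lext2 f x y + lext2 f x y'.
Proof. by rewrite !lext2_swap linearD. Qed.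

Lemma lext2_suml K L V (f : K -> L -> V) (I : finType) (X : I -> {malg k[K]})
    (y : {malg k[L]}) :
  lext2 f (\sum_i X i) y = \sum_i lext2 f (X i) y.
Proof. exact: linear_sum. Qed.

Lemma lext2_sumr K L V (f : K -> L -> V) (I : finType) (x : {malg k[K]})
    (Y : I -> {malg k[L]}) :
  lext2 f x (\sum_i Y i) = \sum_i lext2 f x (Y i).
Proof.
rewrite lext2_swap linear_sum; apply: eq_bigr => i _.
exact/esym/lext2_swap.
Qed.

(** [QSh_plus] is convertible to an instance of this predicate, so the closure lemmas apply to
    it. *)
Definition supported K (P : K -> Prop) (x : {malg k[K]}) : Prop :=
  forall u, u \in msupp x -> P u.

Lemma supported0 K (P : K -> Prop) : supported P 0.
Proof. by move=> u; rewrite msupp0. Qed.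

Lemma supportedU K (P : K -> Prop) u : P u -> supported P << u >>.
Proof. by move=> Pu v /(fsubsetP msuppU_le); rewrite in_fset1 => /eqP->. Qed.

Lemma supportedD K (P : K -> Prop) x y :
  supported P x -> supported P y -> supported P (x + y).
Proof.
move=> Px Py u /(fsubsetP (msuppD_le _ _)).
by rewrite in_fsetU => /orP[/Px|/Py].
Qed.

Lemma supported_lext K L (P : K -> Prop) (f : L -> {malg k[K]}) x :
  {in msupp x, forall u, supported P (f u)} -> supported P (lext f x).
Proof.
move=> Pf; rewrite /lext big_seq; elim/big_ind: _ => [||u xu].
- exact: supported0.
- exact: supportedD.
- by move=> v /(fsubsetP (msuppZ_le _ _)); apply: Pf.
Qed.

End Linear.

(* Unification otherwise unfolds the finitely supported functions when it
   compares distinct basis vectors. *)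
Local Opaque lext lext2 mkmalgU.

(** * Compatibility of the coproduct and the products *)

Section Coproduct.
Variable k : fieldType.
Implicit Types (a b : letter) (u v w : word) (x y : TW k).

HB.instance Definition _ := GRing.Linear.on (@Delta_f k).

Lemma tconsE a x : tcons << a >> x = lext (fun w => << a :: w >>) x.
Proof. exact: lext2Ul. Qed.

Lemma tens1U a : tens1 << a >> = << [:: a] >> :> TW k.
Proof. exact: lextU. Qed.

Lemma tens_nil x : tens << [::] >> x = lext (fun w => << ([::], w) >>) x.
Proof. exact: lext2Ul. Qed.

Lemma tens_nilr x : tens x << [::] >> = lext (fun w => << (w, [::]) >>) x.
Proof. exact: lext2Ur. Qed.

Lemma star_word_cons a u b v :
  star_word k (a :: u) (b :: v) =
  tcons << a >> (star_word k u (b :: v)) +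
  tcons << b >> (star_word k (a :: u) v) +
  tcons << lmul a b >> (star_word k u v).
Proof. by []. Qed.

Lemma tensU u v : tens << u >> << v >> = << (u, v) >> :> TW2 k.
Proof. exact: lext2U. Qed.

Lemma Delta_fU w :
  Delta_f << w >> = \sum_(i < (size w).+1) << (take i w, drop i w) >> :> TW2 k.
Proof. exact: lextU. Qed.

Lemma Delta_fD x y : Delta_f (x + y) = Delta_f x + Delta_f y.
Proof. exact: linearD. Qed.

Lemma tensDl x x' y : tens (x + x') y = tens x y + tens x' y.
Proof. exact: lext2Dl. Qed.

Lemma tensDr x y y' : tens x (y + y') = tens x y + tens x y'.
Proof. exact: lext2Dr. Qed.

Lemma tens0 y : tens (0 : TW k) y = 0.
Proof. exact: lext20l. Qed.

Local Arguments star_word : simpl never.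

Lemma star_word_nil v : star_word k [::] v = << v >>.
Proof. by []. Qed.

Lemma star_word_nilr u : star_word k u [::] = << u >>.
Proof. by case: u. Qed.

Lemma bullet_word_nilr u : bullet_word k u [::] = 0.
Proof. by case: u. Qed.

(** * Deconcatenation of quasi-shuffle products *)

Definition lcons a : TW2 k -> TW2 k := lext (fun p => << (a :: p.1, p.2) >>).

HB.instance Definition _ a := GRing.Linear.on (lcons a).

Lemma lcons_tens a x y : lcons a (tens x y) = tens (tcons << a >> x) y.
Proof.
rewrite tconsE /lcons /tens lext_lext2.
transitivity (lext2 (fun u v => << (a :: u, v) >> : TW2 k) x y).
  by apply: eq_in_lext2 => u v _ _; apply: lextU.
rewrite lext2_swap [RHS]lext2_swap; apply: eq_in_lext => v _.
by rewrite [RHS]lext_lext; apply: eq_in_lext => u _; rewrite lextU.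
Qed.

(** The cut before [a] gives the first summand; every other cut cuts the tail and leaves [a] on the
    left. *)
Lemma Delta_f_tcons a x :
  Delta_f (tcons << a >> x) =
  tens << [::] >> (tcons << a >> x) + lcons a (Delta_f x).
Proof.
rewrite tconsE tens_nil /lcons /Delta_f 2!lext_lext.
rewrite [X in _ + X]lext_lext -lextD.
apply: eq_in_lext => w _; rewrite 2!lextU big_ord_recl; congr (_ + _).
by rewrite linear_sum; apply: eq_bigr => i _; rewrite [RHS]lextU.
Qed.

(** The Sweedler term (u1 * v1) (x) (u2 * v2) for the cuts of [u] at [i] and of [v] at [j]. *)
Definition cut_star u v i j : TW2 k :=
  tens (star_word k (take i u) (take j v)) (star_word k (drop i u) (drop j v)).

(** Here t1, t2, t3 are the terms with left factor 1, a0 and b0 the sums over cuts with exactly one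
    empty prefix, and r, s, t the double sums of the three half products. *)
Fact coproduct_shuffle (V : zmodType) (t1 t2 t3 a0 b0 r s t : V) :
  t1 + (a0 + r) + (t2 + (b0 + s)) + (t3 + t) =
  t1 + t2 + t3 + b0 + (a0 + (r + s + t)).
Proof. by rewrite !addrA [LHS](ACl (1*4*7*5*2*3*6*8)). Qed.

(** Double induction: each of the three terms of the recursion starts with a known letter, so
    [Delta_f_tcons] applies. Where both prefixes are nonempty, the left factor splits by the same
    recursion, and the two sides match term by term. *)
Lemma Delta_f_star_word u v :
  Delta_f (star_word k u v) =
  \sum_(i < (size u).+1) \sum_(j < (size v).+1) cut_star u v i j.
Proof.
elim: u v => [|a u IHu] v.
  rewrite big_ord1 star_word_nil Delta_fU; apply: eq_bigr => j _.
  by rewrite /cut_star !star_word_nil tensU.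
elim: v => [|b v IHv].
  rewrite Delta_fU; apply: eq_bigr => i _; rewrite big_ord1.
  by rewrite /cut_star !star_word_nilr tensU.
pose D i j := star_word k (drop i u) (drop j v).
(* The empty prefix of [b :: v] is set apart: there the left factor is a prefix of [a :: u]
   alone. *)
have coproduct_prec : lcons a (Delta_f (star_word k u (b :: v))) =
    \sum_(i < (size u).+1) cut_star (a :: u) (b :: v) i.+1 0 +
    \sum_(i < (size u).+1) \sum_(j < (size v).+1)
      tens (tcons << a >> (star_word k (take i u) (b :: take j v))) (D i j).
  rewrite IHu linear_sum -big_split; apply: eq_bigr => i _ /=.
  rewrite linear_sum big_ord_recl /=; congr (_ + _).
    by rewrite lcons_tens take0 star_word_nilr tconsU.
  by apply: eq_bigr => j _; rewrite lcons_tens.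
have coproduct_succ : lcons b (Delta_f (star_word k (a :: u) v)) =
    \sum_(j < (size v).+1) cut_star (a :: u) (b :: v) 0 j.+1 +
    \sum_(i < (size u).+1) \sum_(j < (size v).+1)
      tens (tcons << b >> (star_word k (a :: take i u) (take j v))) (D i j).
  rewrite IHv big_ord_recl linearD !linear_sum /=; congr (_ + _).
    apply: eq_bigr => j _; rewrite /cut_star lcons_tens !take0 !drop0.
    by rewrite !star_word_nil tconsU.
  apply: eq_bigr => i _; rewrite linear_sum; apply: eq_bigr => j _.
  by rewrite /= lcons_tens.
have coproduct_bullet : lcons (lmul a b) (Delta_f (star_word k u v)) =
    \sum_(i < (size u).+1) \sum_(j < (size v).+1)
      tens (tcons << lmul a b >> (star_word k (take i u) (take j v))) (D i j).
  rewrite IHu linear_sum; apply: eq_bigr => i _; rewrite linear_sum.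
  by apply: eq_bigr => j _; rewrite /= lcons_tens.
(* These are the cuts with nonempty prefix of [a :: u]; all columns but the first split by the
   recursion of the left factor. *)
have cuts_left : \sum_(i < (size u).+1) \sum_(j < (size v).+2)
      cut_star (a :: u) (b :: v) i.+1 j =
    \sum_(i < (size u).+1) cut_star (a :: u) (b :: v) i.+1 0 +
    (\sum_(i < (size u).+1) \sum_(j < (size v).+1)
      tens (tcons << a >> (star_word k (take i u) (b :: take j v))) (D i j) +
    \sum_(i < (size u).+1) \sum_(j < (size v).+1)
      tens (tcons << b >> (star_word k (a :: take i u) (take j v))) (D i j) +
    \sum_(i < (size u).+1) \sum_(j < (size v).+1)
      tens (tcons << lmul a b >> (star_word k (take i u) (take j v))) (D i j)).
  rewrite -!big_split; apply: eq_bigr => i _; rewrite big_ord_recl.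
  congr (_ + _); rewrite -!big_split; apply: eq_bigr => j _ /=.
  by rewrite -!tensDl.
have cut00 : cut_star (a :: u) (b :: v) 0 0 =
    tens << [::] >> (tcons << a >> (star_word k u (b :: v))) +
    tens << [::] >> (tcons << b >> (star_word k (a :: u) v)) +
    tens << [::] >> (tcons << lmul a b >> (star_word k u v)).
  by rewrite -!tensDr.
rewrite star_word_cons 2!Delta_fD.
have E1 := Delta_f_tcons a (star_word k u (b :: v)).
rewrite coproduct_prec in E1.
have E2 := Delta_f_tcons b (star_word k (a :: u) v).
rewrite coproduct_succ in E2.
have E3 := Delta_f_tcons (lmul a b) (star_word k u v).
rewrite coproduct_bullet in E3.
apply: etrans (congr2 +%R (congr2 +%R E1 E2) E3) _.
rewrite [RHS]big_ord_recl [X in _ = X + _]big_ord_recl.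
rewrite [X in _ = _ + X]cuts_left [X in _ = X + _ + _]cut00.
exact: coproduct_shuffle.
Qed.

(** The two first letters are merged, so apart from the empty cut both prefixes are nonempty; the
    extra terms of the sum vanish. *)
Lemma Delta_f_bullet_word u v :
  Delta_f (bullet_word k u v) =
  tens << [::] >> (bullet_word k u v) +
  \sum_(i < (size u).+1) \sum_(j < (size v).+1)
    tens (bullet_word k (take i u) (take j v))
         (star_word k (drop i u) (drop j v)).
Proof.
have bullet0 w w' : (w == [::]) || (w' == [::]) -> bullet_word k w w' = 0.
  by case/orP=> /eqP->; rewrite ?bullet_word_nilr.
case: u v => [|a u] [|b v].
1-3: rewrite bullet0 ?orbT // linear0 [tens _ 0]lext20r big1 ?addr0 // => i _.
1-3: by rewrite big1 // => j _; rewrite ?bullet0 ?orbT // tens0.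
(* The double sum is the coproduct of the product of the tails with the merged letter prepended on
   the left; its indices are those of the tails moved up by one. *)
rewrite [X in _ = _ + X](_ : _ = lcons (lmul a b) (Delta_f (star_word k u v))).
  exact: Delta_f_tcons.
rewrite Delta_f_star_word.
rewrite [LHS]big_ord_recl /=.
rewrite [X in X + _]big1 => [|j _]; last by rewrite tens0.
rewrite add0r [RHS]linear_sum.
apply: eq_bigr => i _; rewrite [RHS]linear_sum.
rewrite [LHS]big_ord_recl [X in X + _]tens0 add0r; apply: eq_bigr => j _.
exact/esym/lcons_tens.
Qed.

(** * Standardization of shifted products *)

Definition st : TW k -> TW k := lext (fun w => << stw w >>).

HB.instance Definition _ := GRing.Linear.on st.
HB.instance Definition _ := GRing.Linear.on (@st2 k).

Lemma st2_tens x y : st2 (tens x y) = tens (st x) (st y).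
Proof.
rewrite /st2 /st /tens lext_lext2 lext2_lext; apply: eq_in_lext2 => u v _ _ /=.
by rewrite lextU lext2U.
Qed.

Definition map_letters (f : letter -> letter) : TW k -> TW k :=
  lext (fun w => << map f w >>).

HB.instance Definition _ f := GRing.Linear.on (map_letters f).

Lemma map_letters_tcons f a x :
  map_letters f (tcons << a >> x) = tcons << f a >> (map_letters f x).
Proof.
transitivity (lext (fun w => << f a :: map f w >> : TW k) x).
  rewrite tconsE [LHS]lext_lext; apply: eq_in_lext => w _; exact: lextU.
rewrite tconsE [RHS]lext_lext; apply: eq_in_lext => w _; exact/esym/lextU.
Qed.

Section LetterMorphism.
Variable f : letter -> letter.
Hypothesis fM : {morph f : a b / lmul a b}.

(** The recursion uses only the product of letters, hence commutes with every multiplicative letter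
    map, relabellings in particular. *)
Lemma map_star_word u v :
  map_letters f (star_word k u v) = star_word k (map f u) (map f v).
Proof.
elim: u v => [|a u IHu] v; first exact: lextU.
elim: v => [|b v IHv]; first exact: lextU.
rewrite star_word_cons !linearD /=.
apply: etrans (congr2 +%R (congr2 +%R _ _) _) (esym (star_word_cons _ _ _ _)).
- exact: etrans (map_letters_tcons _ _ _) (congr1 _ (IHu (b :: v))).
- exact: etrans (map_letters_tcons _ _ _) (congr1 _ IHv).
- by rewrite -fM; apply: etrans (map_letters_tcons _ _ _) (congr1 _ (IHu v)).
Qed.

Lemma map_bullet_word u v :
  map_letters f (bullet_word k u v) = bullet_word k (map f u) (map f v).
Proof.
case: u v => [|a u] [|b v]; rewrite ?linear0 //=.
by rewrite map_letters_tcons map_star_word fM.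
Qed.

End LetterMorphism.

(** The common support makes [st] a single relabelling; the degree serves to recover multilinearity
    of the words of a product. *)
Definition graded (S : {fset nat}) d : TW k -> Prop :=
  supported (fun w => wsupp w = S /\ wdeg w = d).

Lemma graded_tcons a S d x : graded S d x ->
  graded (finsupp (letter_mon a) `|` S)%fset (mdeg (letter_mon a) + d)
    (tcons << a >> x).
Proof.
move=> gx; rewrite tconsE; apply: supported_lext => w /gx[wS wd].
by apply: supportedU; rewrite wsupp_cons wdeg_cons wS wd.
Qed.

Lemma graded_star_word u v :
  graded (wsupp u `|` wsupp v)%fset (wdeg u + wdeg v) (star_word k u v).
Proof.
elim: u v => [|a u IHu] v.
  by apply: supportedU; rewrite wsupp_nil wdeg_nil fset0U.
elim: v => [|b v IHv].
  by apply: supportedU; rewrite wsupp_nil wdeg_nil fsetU0 addn0.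
rewrite star_word_cons; apply: supportedD; first apply: supportedD.
- rewrite [wsupp (a :: u)]wsupp_cons wdeg_cons -fsetUA -addnA.
  exact: graded_tcons.
- rewrite [wsupp (b :: v)]wsupp_cons [wdeg (b :: v)]wdeg_cons fsetUCA addnCA.
  exact: graded_tcons.
- rewrite !wsupp_cons !wdeg_cons fsetUACA addnACA -mdomD -mdegM.
  exact: graded_tcons.
Qed.

Lemma graded_bullet_word u v :
  graded (wsupp u `|` wsupp v)%fset (wdeg u + wdeg v) (bullet_word k u v).
Proof.
case: u v => [|a u] [|b v]; try exact: supported0.
rewrite !wsupp_cons !wdeg_cons fsetUACA addnACA -mdomD -mdegM.
exact/graded_tcons/graded_star_word.
Qed.

Lemma graded_st S d x : graded S d x -> st x = map_letters (relabel (rank S)) x.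
Proof. by move=> gx; apply: eq_in_lext => w /gx[<-]. Qed.

Definition shifted_star u v := star_word k u (shift (wdeg u) v).
Definition shifted_bullet u v := bullet_word k u (shift (wdeg u) v).

Section ShiftedStandardization.
Variables (n : nat) (u v : word).
Hypotheses (u_lt_n : (wsupp u `<=` initseg n)%fset) (mu : multilinear u).

(** On the common support standardization relabels by one map, which commutes with the product and
    acts on the two factors as computed by the rank lemmas. *)
Lemma st_star_word :
  st (star_word k u (shift n v)) = shifted_star (stw u) (stw v).
Proof.
rewrite (graded_st (@graded_star_word u (shift n v))) map_star_word;
  last exact: relabelM.
by rewrite rank_shift_left // rank_shift_right.
Qed.

Lemma st_bullet_word :
  st (bullet_word k u (shift n v)) = shifted_bullet (stw u) (stw v).
Proof.
rewrite (graded_st (@graded_bullet_word u (shift n v))) map_bullet_word;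
  last exact: relabelM.
by rewrite rank_shift_left // rank_shift_right.
Qed.

End ShiftedStandardization.

(** * The coproduct of a bullet product *)

Definition cuts w : TW2 k :=
  \sum_(i < (size w).+1) << (stw (take i w), stw (drop i w)) >>.

Lemma DeltaE x : Delta x = lext cuts x.
Proof.
rewrite /Delta /st2 /Delta_f lext_lext; apply: eq_in_lext => w _.
by rewrite linear_sum; apply: eq_bigr => i _; apply: lextU.
Qed.

(* Since bullet_word vanishes on the empty word, only the pairs with both left
   factors nonempty contribute. *)
Definition bullet_star : TW2 k -> TW2 k -> TW2 k :=
  lext2 (fun p q => tens (shifted_bullet p.1 q.1) (shifted_star p.2 q.2)).

Lemma Delta_shifted_bullet n m u v : QSh_basis n u -> QSh_basis m v ->
  Delta (shifted_bullet u v) =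
  tens << [::] >> (shifted_bullet u v) + bullet_star (cuts u) (cuts v).
Proof.
move=> /QSh_basisP[un mu] /QSh_basisP[vm mv].
have du : wdeg u = n by rewrite mu un card_initseg.
rewrite /Delta {1}/shifted_bullet Delta_f_bullet_word linearD /= st2_tens.
rewrite du; apply: (congr2 +%R).
  apply: (congr2 (@tens k)); first exact: lextU.
  rewrite st_bullet_word ?un ?fsubset_refl //.
  by rewrite (stw_initseg un) (stw_initseg vm).
rewrite [LHS]linear_sum [RHS]lext2_suml; apply: eq_bigr => i _.
(* Both pieces of a cut of [u] stay multilinear and supported in [n], as standardizing their
   products with the shifted pieces of [v] requires. *)
have := mu; rewrite -{1}(cat_take_drop i u) => /multilinear_cat[mt md].
have := fsubset_refl (initseg n).
rewrite -{1}un -{1}(cat_take_drop i u) wsupp_cat fsubUset => /andP[tn dn].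
rewrite [LHS]linear_sum [RHS]lext2_sumr size_map; apply: eq_bigr => j _ /=.
rewrite [RHS]lext2U -map_take -map_drop st2_tens; apply: (congr2 (@tens k)).
  exact: st_bullet_word.
exact: st_star_word.
Qed.

Lemma Delta_bullet x y : QSh_plus x -> QSh_plus y ->
  Delta (bullet x y) =
  tens << [::] >> (bullet x y) + bullet_star (Delta x) (Delta y).
Proof.
move=> Qx Qy; rewrite !DeltaE /bullet_star lext2_lext tens_nil /bullet.
rewrite !lext_lext2 -lext2D; apply: eq_in_lext2 => u v /Qx[n _ un] /Qy[m _ vm].
by rewrite /= -DeltaE -tens_nil; apply: Delta_shifted_bullet un vm.
Qed.

Lemma bullet_star_tens_nil x y :
  bullet_star (tens x << [::] >>) (tens y << [::] >>) =
  tens (bullet x y) << [::] >>.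
Proof.
rewrite /bullet_star !tens_nilr lext2_lext lext_lext2.
apply: eq_in_lext2 => u v _ _ /=; rewrite lext2U -tens_nilr.
by congr tens.
Qed.

Lemma bullet_star_nill x q : bullet_star (tens << [::] >> x) q = 0.
Proof.
(* Writing [q] as a linear extension lets [lext2_lext] reduce the claim to basis vectors. *)
rewrite -[q in LHS]malg_lextE /bullet_star tens_nil lext2_lext.
by apply: lext2_eq0 => u v; rewrite lext2U tens0.
Qed.

Lemma bullet_star_nilr p y : bullet_star p (tens << [::] >> y) = 0.
Proof.
rewrite -[p in LHS]malg_lextE /bullet_star tens_nil lext2_lext.
apply: lext2_eq0 => u v.
by rewrite lext2U /shifted_bullet bullet_word_nilr tens0.
Qed.

(** Of the four products, those with an empty left factor vanish. *)
Lemma bullet_star_primitive x y :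
  bullet_star (tens x << [::] >> + tens << [::] >> x)
              (tens y << [::] >> + tens << [::] >> y) =
  tens (bullet x y) << [::] >>.
Proof.
rewrite [LHS]lext2Dl [X in _ + X]bullet_star_nill addr0.
rewrite [LHS]lext2Dr [X in _ + X]bullet_star_nilr addr0.
exact: bullet_star_tens_nil.
Qed.

(** Every word of the product has support [n] united with n + [m], that is [n + m], and degree n +
    m. *)
Lemma QSh_plus_bullet x y : QSh_plus x -> QSh_plus y -> QSh_plus (bullet x y).
Proof.
move=> Qx Qy; apply: supported_lext => u /Qx[n n_gt0 /QSh_basisP[un mu]].
apply: supported_lext => v /Qy[m _ /QSh_basisP[vm mv]] w.
case/graded_bullet_word=> ws wd.
have dn : wdeg u = n by rewrite mu un card_initseg.
have dm : wdeg v = m by rewrite mv vm card_initseg.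
exists (n + m)%N; first by rewrite addn_gt0 n_gt0.
apply/QSh_basisP; have ew : wsupp w = initseg (n + m).
  apply/fsetP => i.
  rewrite ws un /shift wsupp_relabel in_fsetU !in_initseg vm dn.
  have [lt_in|le_ni] := ltnP; first by rewrite ltn_addr.
  rewrite -(subnKC le_ni) ltn_add2l /= -in_initseg.
  by apply/imfsetP/idP => [[j /= jm /addnI->]|jm] //; exists (i - n)%N.
by rewrite /multilinear ew card_initseg wd wdeg_relabel dn dm.
Qed.

Lemma primitive_bullet x y :
  primitive x -> primitive y -> primitive (bullet x y).
Proof.
move=> [Qx Dx] [Qy Dy]; split; first exact: QSh_plus_bullet.
apply: etrans (Delta_bullet Qx Qy) (etrans (addrC _ _) (congr1 (+%R^~ _) _)).
exact: etrans (congr2 bullet_star Dx Dy) (bullet_star_primitive x y).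
Qed.

(** * The generators of Com *)

Lemma comgen_initseg n :
  wsupp [:: comgen n] = initseg n.+1 /\ multilinear [:: comgen n].
Proof.
rewrite /multilinear wsupp_cons wdeg_cons wsupp_nil wdeg_nil addn0 fsetU0.
by rewrite finsupp_xset mdeg_xset.
Qed.

(** A word of length one has only the two trivial cuts. *)
Lemma cuts_letter a : stw [:: a] = [:: a] ->
  cuts [:: a] = << ([:: a], [::]) >> + << ([::], [:: a]) >>.
Proof.
move=> e; rewrite /cuts big_ord_recl.
apply: etrans (addrC _ _) (congr2 +%R _ _); last by rewrite /= e.
by rewrite big_ord1 /= e.
Qed.

Lemma primitive_Com (p : W k) : Com p -> primitive (tens1 p).
Proof.
move=> Cp; split.
  apply: supported_lext => a /Cp[n ->]; apply: supportedU.
  by exists n.+1 => //; apply/QSh_basisP/comgen_initseg.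
rewrite DeltaE tens_nil tens_nilr /tens1 lext_lext.
rewrite [X in _ = X + _]lext_lext [X in _ = _ + X]lext_lext -lextD.
apply: eq_in_lext => a /Cp[n ->].
rewrite [LHS]lextU [X in _ = X + _]lextU [X in _ = _ + X]lextU.
exact/cuts_letter/stw_initseg/(proj1 (comgen_initseg n)).
Qed.

(** Both sides are multilinear with the same support, which determines the monomial. *)
Lemma comgen_recl n :
  lmul (comgen 0) (relabel (addn 1) (comgen n)) = comgen n.+1.
Proof.
apply/val_inj; rewrite [RHS]/=.
have supp_comgen :
    finsupp (val (lmul (comgen 0) (relabel (addn 1) (comgen n)))) = initseg n.+2.
  rewrite mdomD finsupp_relabel_mon !finsupp_xset; apply/fsetP => i.
  rewrite in_fsetU !in_initseg; case: i => [|i] /=; first by [].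
  rewrite ltnS -in_initseg -add1n.
  by apply/imfsetP/idP => [[j /= jn /addnI->]|jn] //; exists i.
rewrite -supp_comgen; apply: xset_finsupp.
rewrite supp_comgen card_initseg mdegM mdeg_relabel_mon !mdeg_xset.
by rewrite !card_initseg.
Qed.

(** [iterop] nests to the right, so each step multiplies by [comgen 0] on the left; with [n.+1]
    factors its default value 0 is never reached. *)
Lemma comgen_iterop n :
  tens1 << comgen n >> = iterop n.+1 (@bullet k) (tens1 << comgen 0 >>) 0.
Proof.
elim: n => [|n IHn] //; apply: etrans _ (congr1 (bullet _) IHn).
rewrite [LHS]tens1U; apply: esym.
apply: etrans (congr2 (@bullet k) (tens1U _) (tens1U _)) _.
rewrite [LHS]lext2U.
(* The left factor has degree 1, so the right one is shifted by 1, as in [comgen_recl]. *)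
have [e m] := comgen_initseg 0.
rewrite m e card_initseg; apply: etrans (tconsU _ _ _) _.
by rewrite comgen_recl.
Qed.

End Coproduct.

Theorem theorem20 (k : fieldType) :
  [/\ forall n : nat,
        tens1 << comgen n >> =
          iterop n.+1 (@bullet k) (tens1 << comgen 0 >>) 0,
      forall p : W k, Com p -> primitive (tens1 p)
    & forall x y : TW k,
        primitive x -> primitive y -> primitive (bullet x y)].
Proof.
split; [exact: comgen_iterop | exact: primitive_Com | exact: primitive_bullet].
Qed.
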